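(* Let $(G_1,G_2)$ be a composable pair and let $G$ be the split unification of $(G_1,G_2)$. Then for each $H\in\{P_5,\overline{P_5},C_5\}$, $G$ is $H$-free if and only if both $G_1$ and $G_2$ are $H$-free.
   Context: $P_5$ is the path on 5 vertices, $C_5$ the 5-cycle, $\overline{P_5}$ the complement of $P_5$. A graph is $H$-free if it has no induced subgraph isomorphic to $H$. For $S\subseteq V(G)$ and $v\notin S$: $v$ is complete to $S$ if adjacent to all of $S$, anticomplete if adjacent to none, mixed on $S$ otherwise; a set is complete (anticomplete) to a disjoint set if each of its vertices is. An anticomponent of $S$ is a subset of $S$ inducing a connected component of the complement of $G[S]$. Composable pair: let $A,B,C,L,T$ be pairwise disjoint sets with $A,C$ non-empty, and $a^*,c^*$ two distinct vertices not in $A\cup B\cup C\cup L\cup T$. $G_1$ is a graph on $A\cup B\cup L\cup T\cup\{c^*\}$ such that $L$ is a (possibly empty) clique, $T$ is a (possibly empty) stable set, $A$ is complete to $B$ and anticomplete to $T$, some vertex of $A$ is complete to $L$, and $c^*$ is complete to $B\cup L$ and anticomplete to $A\cup T$ (other adjacencies arbitrary). $G_2$ is a graph on $B\cup C\cup L\cup T\cup\{a^*\}$ such that $G_2[B\cup L\cup T]=G_1[B\cup L\cup T]$, $T$ is anticomplete to $C$, $L$ is complete to $B\cup C$, $a^*$ is complete to $B\cup L$ and anticomplete to $C\cup T$, some vertex of $C$ is complete to $B$, and no vertex of $C$ is mixed on any anticomponent of $B$ (other adjacencies arbitrary). Then $(G_1,G_2)$ is a composable pair. Its split unification is the graph $G$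 on $A\cup B\cup C\cup L\cup T$ with $G[A\cup B\cup L\cup T]=G_1\setminus c^*$, $G[B\cup C\cup L\cup T]=G_2\setminus a^*$, and $A$ anticomplete to $C$. *)

(* Defs.v *)
From mathcomp Require Import all_boot.

Set Implicit Arguments.
Unset Strict Implicit.
Unset Printing Implicit Defensive.

(* Finite simple graphs whose vertex set is a subset of an ambient finite type,
   so that graphs sharing some of their vertices can be compared. *)
Record sgraph (V : finType) := SGraph {
  vset : {set V};
  adj : rel V;
  adj_sym : symmetric adj;
  adj_irr : irreflexive adj;
  adj_vset : forall x y, adj x y -> (x \in vset) && (y \in vset)
}.

Definition same_graph (V : finType) (G H : sgraph V) : Prop :=
  vset G = vset H /\ adj G =2 adj H.

Section Induced.
Variables (V : finType) (G : sgraph V) (S : {set V}).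

Definition induced_adj : rel V :=
  fun x y => [&& x \in S, y \in S & adj G x y].

Fact induced_sym : symmetric induced_adj.
Proof. by move=> x y; rewrite /induced_adj adj_sym andbCA. Qed.

Fact induced_irr : irreflexive induced_adj.
Proof. by move=> x; rewrite /induced_adj adj_irr !andbF. Qed.

Fact induced_vset x y :
  induced_adj x y -> (x \in S :&: vset G) && (y \in S :&: vset G).
Proof.
by case/and3P=> xS yS /adj_vset /andP[xG yG]; rewrite !inE xS yS xG yG.
Qed.

Definition induced : sgraph V := SGraph induced_sym induced_irr induced_vset.
End Induced.

Definition delete_vertex (V : finType) (G : sgraph V) (v : V) : sgraph V :=
  induced G (vset G :\ v).

Section Complement.
Variables (V : finType) (G : sgraph V).

Definition compl_adj : rel V :=
  fun x y => [&& x \in vset G, y \in vset G, x != y & ~~ adj G x y].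

Fact compl_sym : symmetric compl_adj.
Proof. by move=> x y; rewrite /compl_adj adj_sym andbCA eq_sym. Qed.

Fact compl_irr : irreflexive compl_adj.
Proof. by move=> x; rewrite /compl_adj eqxx !andbF. Qed.

Fact compl_vset x y : compl_adj x y -> (x \in vset G) && (y \in vset G).
Proof. by case/and4P=> -> ->. Qed.

Definition compl : sgraph V := SGraph compl_sym compl_irr compl_vset.
End Complement.

Definition isomorphic (V W : finType) (G : sgraph V) (H : sgraph W) : Prop :=
  exists f : V -> W,
    [/\ {in vset G &, injective f},
        f @: vset G = vset H
      & {in vset G &, forall x y, adj H (f x) (f y) = adj G x y}].

Definition free (V W : finType) (H : sgraph W) (G : sgraph V) : Prop :=
  ~ exists2 S : {set V}, S \subset vset G & isomorphic H (induced G S).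

Section P5.
Definition P5_adj : rel 'I_5 := fun i j => (i.+1 == j) || (j.+1 == i).

Fact P5_sym : symmetric P5_adj.
Proof. by move=> i j; rewrite /P5_adj orbC. Qed.

Fact P5_irr : irreflexive P5_adj.
Proof. by move=> i; rewrite /P5_adj orbb gtn_eqF. Qed.

Fact P5_vset i j : P5_adj i j -> (i \in [set: 'I_5]) && (j \in [set: 'I_5]).
Proof. by rewrite !in_setT. Qed.

Definition P5 : sgraph 'I_5 := SGraph P5_sym P5_irr P5_vset.
End P5.

Section C5.
Definition C5_adj : rel 'I_5 :=
  fun i j => (i.+1 == j %[mod 5]) || (j.+1 == i %[mod 5]).

Fact C5_sym : symmetric C5_adj.
Proof. by move=> i j; rewrite /C5_adj orbC. Qed.

Fact C5_irr : irreflexive C5_adj.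
Proof. by case=> [[|[|[|[|[|]]]]]]. Qed.

Fact C5_vset i j : C5_adj i j -> (i \in [set: 'I_5]) && (j \in [set: 'I_5]).
Proof. by rewrite !in_setT. Qed.

Definition C5 : sgraph 'I_5 := SGraph C5_sym C5_irr C5_vset.
End C5.

Section Adjacency.
Variables (V : finType) (G : sgraph V).

Definition clique (S : {set V}) : Prop :=
  {in S &, forall x y, x != y -> adj G x y}.

Definition stable (S : {set V}) : Prop :=
  {in S &, forall x y, ~~ adj G x y}.

Definition vcomplete (v : V) (S : {set V}) : Prop :=
  {in S, forall s, adj G v s}.

Definition vanticomplete (v : V) (S : {set V}) : Prop :=
  {in S, forall s, ~~ adj G v s}.

Definition mixed (v : V) (S : {set V}) : Prop :=
  ~ vcomplete v S /\ ~ vanticomplete v S.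

Definition complete (X Y : {set V}) : Prop :=
  {in X, forall x, vcomplete x Y}.

Definition anticomplete (X Y : {set V}) : Prop :=
  {in X, forall x, vanticomplete x Y}.

Definition component (K : {set V}) : Prop :=
  exists2 x, x \in vset G & K = [set y | connect (adj G) x y].
End Adjacency.

Definition anticomponent (V : finType) (G : sgraph V) (S K : {set V}) : Prop :=
  component (compl (induced G S)) K.

Section SplitUnification.
Variables (V : finType) (A B C L T : {set V}) (a c : V).

Record composable_sets : Prop := {
  cs_disjoint : pairwise (fun X Y : {set V} => [disjoint X & Y])
                         [:: A; B; C; L; T];
  cs_A : A != set0;
  cs_C : C != set0;
  cs_ac : a != c;
  cs_a : a \notin A :|: B :|: C :|: L :|: T;
  cs_c : c \notin A :|: B :|: C :|: L :|: T
}.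

Record composable_left (G1 : sgraph V) : Prop := {
  cl_vset : vset G1 = A :|: B :|: L :|: T :|: [set c];
  cl_L : clique G1 L;
  cl_T : stable G1 T;
  cl_AB : complete G1 A B;
  cl_AT : anticomplete G1 A T;
  cl_AL : exists2 x, x \in A & vcomplete G1 x L;
  cl_cBL : vcomplete G1 c (B :|: L);
  cl_cAT : vanticomplete G1 c (A :|: T)
}.

Record composable_right (G1 G2 : sgraph V) : Prop := {
  cr_vset : vset G2 = B :|: C :|: L :|: T :|: [set a];
  cr_common : same_graph (induced G2 (B :|: L :|: T))
                         (induced G1 (B :|: L :|: T));
  cr_TC : anticomplete G2 T C;
  cr_LBC : complete G2 L (B :|: C);
  cr_aBL : vcomplete G2 a (B :|: L);
  cr_aCT : vanticomplete G2 a (C :|: T);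
  cr_CB : exists2 x, x \in C & vcomplete G2 x B;
  cr_mixed : forall x K, x \in C -> anticomponent G2 B K -> ~ mixed G2 x K
}.

Definition composable_pair (G1 G2 : sgraph V) : Prop :=
  [/\ composable_sets, composable_left G1 & composable_right G1 G2].

Record split_unification (G1 G2 G : sgraph V) : Prop := {
  su_vset : vset G = A :|: B :|: C :|: L :|: T;
  su_left : same_graph (induced G (A :|: B :|: L :|: T)) (delete_vertex G1 c);
  su_right : same_graph (induced G (B :|: C :|: L :|: T)) (delete_vertex G2 a);
  su_AC : anticomplete G A C
}.

End SplitUnification.

Lemma split_unification_exists (V : finType) (A B C L T : {set V}) (a c : V)
    (G1 G2 : sgraph V) :
  composable_pair A B C L T a c G1 G2 ->
  exists G, split_unification A B C L T a c G1 G2 G.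
Proof.
case=> -[dis _ _ ac aN cN] [v1 _ _ _ _ _ _ _] [v2 [_ com] _ _ _ _ _ _].
set X := A :|: B :|: L :|: T; set Y := B :|: C :|: L :|: T.
pose r x y := induced_adj G1 X x y || induced_adj G2 Y x y.
have rs : symmetric r by move=> x y; rewrite /r induced_sym [X in _ || X]induced_sym.
have ri : irreflexive r by move=> x; rewrite /r !induced_irr.
have rv x y : r x y -> (x \in A :|: B :|: C :|: L :|: T) && (y \in A :|: B :|: C :|: L :|: T).
  by case/orP=> /and3P[]; rewrite !inE => /orP[/orP[/orP[]|]|] -> /orP[/orP[/orP[]|]|] -> _; rewrite ?orbT.
have D S1 S2 x : [disjoint S1 & S2] -> x \in S1 -> x \in S2 = false by move/disjointFr=> h /h.
move: dis => /=; rewrite !andbT => /and4P[/and4P[AB AC AL AT] /and3P[BC BL BT] /andP[CL CT] LT].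
have eqX x : x \in A :|: B :|: C :|: L :|: T -> x \in X -> x \in Y -> x \in B :|: L :|: T.
  rewrite !inE => _; case xA: (x \in A); last by case: (x \in B).
  by rewrite (disjointFr AB) // (disjointFr AC) // (disjointFr AL) // (disjointFr AT).
have key x y : x \in X -> y \in X -> x \in Y -> y \in Y -> adj G2 x y = adj G1 x y.
  have UX z : z \in X -> z \in A :|: B :|: C :|: L :|: T.
    by rewrite !inE => /orP[/orP[/orP[]|]|] ->; rewrite ?orbT.
  move=> xX yX xY yY; have := com x y; rewrite /= /induced_adj.
  by rewrite (eqX x) ?(eqX y) ?UX.
have cX : c \notin X by apply: contra cN; rewrite !inE => /orP[/orP[/orP[]|]|] ->; rewrite ?orbT.
have aY : a \notin Y by apply: contra aN; rewrite !inE => /orP[/orP[/orP[]|]|] ->; rewrite ?orbT.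
have d1 : vset G1 :\ c = X by rewrite v1 setUC setU1K.
have d2 : vset G2 :\ a = Y by rewrite v2 setUC setU1K.
exists (SGraph rs ri rv); split=> //=.
- split=> /=.
    rewrite d1 v1 (setIidPl _); last by apply/subsetP=> x; rewrite !inE => /orP[/orP[/orP[]|]|] ->; rewrite ?orbT.
    by rewrite (setIidPl _) // subsetUl.
  move=> x y /=; rewrite d1 /induced_adj /= /r /induced_adj.
  case xX: (x \in X) => //; case yX: (y \in X) => //=.
  case xY: (x \in Y); case yY: (y \in Y); rewrite ?orbF //=.
  by rewrite key // orbb.
- split=> /=.
    rewrite d2 v2 (setIidPl _); last by apply/subsetP=> x; rewrite !inE => /orP[/orP[/orP[]|]|] ->; rewrite ?orbT.
    by rewrite (setIidPl _) // subsetUl.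
  move=> x y /=; rewrite d2 /induced_adj /= /r /induced_adj.
  case xY: (x \in Y) => //; case yY: (y \in Y) => //=.
  case xX: (x \in X); case yX: (y \in X); rewrite ?orbF //=.
  by rewrite key // orbb.
- move=> x xA y yC; rewrite /= /r /induced_adj !inE xA.
  rewrite yC (disjointFr AB) // (disjointFr AC) // (disjointFr AL) // (disjointFr AT) //.
  rewrite (disjointFl AC) // (disjointFl BC) // (disjointFr CL) // (disjointFr CT) //.
Qed.

(* Main.v *)
Require Import Defs.
From mathcomp Require Import all_boot.

Set Implicit Arguments.
Unset Strict Implicit.
Unset Printing Implicit Defensive.

(** Replacing [c] by a vertex of [C] complete to [B] embeds [G1] in [G], and
    replacing [a] by a vertex of [A] complete to [L] embeds [G2] in [G].
    Conversely, label the vertices of a copy of [H] in [G] by the parts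
    containing them.  The adjacencies that the construction forces between the
    parts, and the fact that two nonadjacent vertices of [B] have the same
    neighbours in [C], leave few labellings; checking them all shows that
    either the vertices labelled [A] are pairwise nonadjacent and complete to
    those labelled [L], so that they can be replaced by [a] to give a copy of
    [H] in [G2], or the vertices labelled [C] are pairwise nonadjacent and
    complete to those labelled [B], and replacing them by [c] gives a copy of
    [H] in [G1].  No two vertices of [H] have the same neighbours, so these
    replacements are automatically injective. *)

(** * Induced copies as adjacency-preserving maps *)

Section Embedding.
Variables (V W : finType).
Implicit Types (G : sgraph V) (H : sgraph W).

Definition point_determining H :=
  forall i j, (forall k, adj H i k = adj H j k) -> i = j.

Definition embedding H G (f : W -> V) :=
  (forall i, f i \in vset G) /\ (forall i j, adj G (f i) (f j) = adj H i j).

Lemma freeP H G : vset H = setT -> point_determining H ->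
  free H G <-> ~ exists f, embedding H G f.
Proof.
move=> HT Hpd; split=> nf.
  case=> f [fG fadj]; apply: nf; exists (f @: setT).
    by apply/subsetP=> _ /imsetP[i _ ->].
  exists f; split.
  - move=> i j _ _ fij; apply: Hpd => k.
    by rewrite -!fadj fij.
  - rewrite HT /=; apply/esym/setIidPl/subsetP=> _ /imsetP[i _ ->].
    exact: fG.
  - by move=> i j _ _; rewrite /= /induced_adj !imset_f ?inE //= fadj.
case=> S SG [f [_ fS fadj]]; apply: nf; exists f.
have fSG i : f i \in S :&: vset G.
  by rewrite -[_ :&: _]fS imset_f // HT inE.
split=> [i|i j]; first by case/setIP: (fSG i).
rewrite -fadj ?HT ?inE //= /induced_adj.
by case/setIP: (fSG i) => -> _; case/setIP: (fSG j) => -> _.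
Qed.

(** All [P]-vertices are sent to the single vertex [x]. For point-determining [H] the last two
    conditions already force at most one index to satisfy [P]. *)
Lemma embedding_replace H G G' f (P : pred W) x :
    embedding H G f -> x \in vset G' ->
    (forall i, ~~ P i -> f i \in vset G') ->
    (forall i j, ~~ P i -> ~~ P j -> adj G' (f i) (f j) = adj G (f i) (f j)) ->
    (forall i j, P i -> P j -> ~~ adj G (f i) (f j)) ->
    (forall i j, P i -> ~~ P j -> adj G' x (f j) = adj G (f i) (f j)) ->
  embedding H G' (fun i => if P i then x else f i).
Proof.
move=> [fG fadj] xG' PG' eqN eqP eqPN; split=> [i|i j].
  by case: ifPn => // /PG'.
rewrite -fadj; case: ifPn => Pi; case: ifPn => Pj.
- by rewrite adj_irr (negbTE (eqP _ _ Pi Pj)).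
- exact: eqPN.
- by rewrite adj_sym (eqPN j i) // adj_sym.
- exact: eqN.
Qed.

End Embedding.

(** * Labellings of a five-vertex pattern by the parts *)

Variant part := InA | InB | InC | InL | InT.

(** The value concerns two distinct vertices; [None] means no uniform answer. [B]-[C] pairs are
    among these, constrained only by [respects_mixed]. *)
Definition forced (X Y : part) : option bool :=
  match X, Y with
  | InA, InB | InB, InA | InL, InB | InB, InL | InL, InC | InC, InL
  | InL, InL => Some true
  | InA, InT | InT, InA | InA, InC | InC, InA | InT, InC | InC, InT
  | InT, InT => Some false
  | _, _ => None
  end.

Definition isA X := if X is InA then true else false.
Definition isB X := if X is InB then true else false.
Definition isC X := if X is InC then true else false.
Definition isL X := if X is InL then true else false.

(* An explicit enumeration, because [enum 'I_5] does not reduce. *)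
Definition ords5 : seq 'I_5 :=
  [:: @Ordinal 5 0 isT; @Ordinal 5 1 isT; @Ordinal 5 2 isT;
      @Ordinal 5 3 isT; @Ordinal 5 4 isT].

Lemma mem_ords5 i : i \in ords5.
Proof. by case: i => [[|[|[|[|[|]]]]] ?]. Qed.

Definition all5 (P : pred 'I_5) := all P ords5.

Lemma all5P (P : pred 'I_5) : reflect (forall i, P i) (all5 P).
Proof.
by apply: (iffP allP) => [h i|h i _]; [apply: h; apply: mem_ords5 | apply: h].
Qed.

Section Labelling.
Variables (e : rel 'I_5) (lab : 'I_5 -> part).

Definition respects_forced := all5 (fun i => all5 (fun j =>
  (i != j) ==>
  (if forced (lab i) (lab j) is Some b then e i j == b else true))).

Definition respects_mixed := all5 (fun i => isC (lab i) ==> all5 (fun j =>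
  isB (lab j) ==> all5 (fun k =>
    [&& isB (lab k), j != k & ~~ e j k] ==> (e i j == e i k)))).

(** Adjacency to one part [Y] is enough: from [A] only the pairs with [L], and from [C] only those
    with [B], are left open by [forced] outside the part itself. *)
Definition replaceable (isX isY : pred part) := all5 (fun i =>
  isX (lab i) ==> all5 (fun j =>
    (isX (lab j) ==> ~~ e i j) && (isY (lab j) ==> e i j))).

Definition labelling_ok :=
  respects_forced ==> respects_mixed ==>
  replaceable isA isL || replaceable isC isB.

End Labelling.

Definition all_parts (P : pred part) :=
  [&& P InA, P InB, P InC, P InL & P InT].

Lemma all_partsP P : all_parts P -> forall X, P X.
Proof. by case/and5P=> ? ? ? ? ? []. Qed.

Definition all_labellings_ok e :=
  all_parts (fun x0 => all_parts (fun x1 => all_parts (fun x2 =>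
  all_parts (fun x3 => all_parts (fun x4 =>
    labelling_ok e (fun i => nth InA [:: x0; x1; x2; x3; x4] i)))))).

Definition twin_free (e : rel 'I_5) :=
  all5 (fun i => all5 (fun j => all5 (fun k => e i k == e j k) ==> (i == j))).

Lemma twin_freeP (H : sgraph 'I_5) e :
  adj H =2 e -> twin_free e -> point_determining H.
Proof.
move=> He /all5P te i j eij.
move/all5P: (te i) => /(_ j) /implyP h; apply/eqP/h.
by apply/all5P=> k; rewrite -!He eij.
Qed.

(* [labelling_ok] evaluates [lab] only at the members of [ords5], so conversion
   identifies [lab] with its list of values. *)
Lemma all_labellings_okP e (lab : 'I_5 -> part) :
  all_labellings_ok e -> labelling_ok e lab.
Proof.
move=> ok.
exact: (all_partsP (all_partsP (all_partsP (all_partsP (all_partsP ok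
  (lab (@Ordinal 5 0 isT))) (lab (@Ordinal 5 1 isT))) (lab (@Ordinal 5 2 isT)))
  (lab (@Ordinal 5 3 isT))) (lab (@Ordinal 5 4 isT))).
Qed.

(** Evaluation of all $5^5$ labellings; under [lazy], a labelling that violates [respects_forced] is
    dismissed before the other tests. *)
Lemma P5_check : twin_free P5_adj && all_labellings_ok P5_adj.
Proof. by lazy. Qed.

Lemma C5_check : twin_free C5_adj && all_labellings_ok C5_adj.
Proof. by lazy. Qed.

Definition coP5_adj : rel 'I_5 := fun i j => (i != j) && ~~ P5_adj i j.

Lemma coP5_check : twin_free coP5_adj && all_labellings_ok coP5_adj.
Proof. by lazy. Qed.

Lemma pattern_check (H : sgraph 'I_5) :
    [\/ H = P5, H = compl P5 | H = C5] ->
  vset H = setT /\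
  exists2 e, adj H =2 e & twin_free e && all_labellings_ok e.
Proof.
case=> ->; split=> //.
- by exists P5_adj => //; apply: P5_check.
- exists coP5_adj; last exact: coP5_check.
  by move=> i j; rewrite /= /compl_adj !inE.
- by exists C5_adj => //; apply: C5_check.
Qed.

(** * Adjacencies between the parts of the split unification *)

Section SplitUnification.
Variables (V : finType) (A B C L T : {set V}) (a c : V) (G1 G2 G : sgraph V).
Hypothesis (Hpair : composable_pair A B C L T a c G1 G2).
Hypothesis (HG : split_unification A B C L T a c G1 G2 G).

Definition part_set X :=
  match X with InA => A | InB => B | InC => C | InL => L | InT => T end.

(** [InT] is also the default outside [vset G], hence the hypothesis of [part_ofP]. *)
Definition part_of x :=
  if x \in A then InA else if x \in B then InB else if x \in C then InC
  else if x \in L then InL else InT.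

Lemma part_ofP x : x \in vset G -> x \in part_set (part_of x).
Proof.
rewrite (su_vset HG) !inE /part_of; case: ifP => //; case: ifP => //.
by case: ifP => //; case: ifP.
Qed.

Lemma part_vset X x : x \in part_set X -> x \in vset G.
Proof. by rewrite (su_vset HG) !inE; case: X => /= ->; rewrite ?orbT. Qed.

Lemma part_neq_a X x : x \in part_set X -> x != a.
Proof.
case: Hpair => -[_ _ _ _ aN _] _ _ xX; apply: contraNneq aN => <-.
by rewrite -(su_vset HG) (part_vset xX).
Qed.

Lemma part_neq_c X x : x \in part_set X -> x != c.
Proof.
case: Hpair => -[_ _ _ _ _ cN] _ _ xX; apply: contraNneq cN => <-.
by rewrite -(su_vset HG) (part_vset xX).
Qed.

Lemma part_vset1 X x : x \in part_set X -> ~~ isC X -> x \in vset G1.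
Proof.
case: Hpair => _ G1P _; rewrite (cl_vset G1P) !inE.
by case: X => //= ->; rewrite ?orbT.
Qed.

Lemma part_vset2 X x : x \in part_set X -> ~~ isA X -> x \in vset G2.
Proof.
case: Hpair => _ _ G2P; rewrite (cr_vset G2P) !inE.
by case: X => //= ->; rewrite ?orbT.
Qed.

Lemma vset1P x : x \in vset G1 -> x != c ->
  exists2 X, ~~ isC X & x \in part_set X.
Proof.
case: Hpair => _ G1P _; rewrite (cl_vset G1P) !inE => + /negbTE xc.
by rewrite xc orbF => /orP[/orP[/orP[]|]|] xX;
  [exists InA | exists InB | exists InL | exists InT].
Qed.

Lemma vset2P x : x \in vset G2 -> x != a ->
  exists2 X, ~~ isA X & x \in part_set X.
Proof.
case: Hpair => _ _ G2P; rewrite (cr_vset G2P) !inE => + /negbTE xa.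
by rewrite xa orbF => /orP[/orP[/orP[]|]|] xX;
  [exists InB | exists InC | exists InL | exists InT].
Qed.

Lemma adj_left X Y x y : x \in part_set X -> y \in part_set Y ->
  ~~ isC X -> ~~ isC Y -> adj G x y = adj G1 x y.
Proof.
move=> xX yY XC YC; have [_ /(_ x y)] := su_left HG.
rewrite /= /induced_adj !in_setD1 (part_neq_c xX) (part_neq_c yY).
rewrite (part_vset1 xX) // (part_vset1 yY) //= => <-.
suff in_left Z z : z \in part_set Z -> ~~ isC Z -> z \in A :|: B :|: L :|: T.
  by rewrite (in_left X) // (in_left Y).
by rewrite !inE; case: Z => //= ->; rewrite ?orbT.
Qed.

Lemma adj_right X Y x y : x \in part_set X -> y \in part_set Y ->
  ~~ isA X -> ~~ isA Y -> adj G x y = adj G2 x y.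
Proof.
move=> xX yY XA YA; have [_ /(_ x y)] := su_right HG.
rewrite /= /induced_adj !in_setD1 (part_neq_a xX) (part_neq_a yY).
rewrite (part_vset2 xX) // (part_vset2 yY) //= => <-.
suff in_right Z z : z \in part_set Z -> ~~ isA Z -> z \in B :|: C :|: L :|: T.
  by rewrite (in_right X) // (in_right Y).
by rewrite !inE; case: Z => //= ->; rewrite ?orbT.
Qed.

Lemma adj_forced X Y x y b : x \in part_set X -> y \in part_set Y ->
  x != y -> forced X Y = Some b -> adj G x y = b.
Proof.
case: Hpair => _ [_ cL cT cAB cAT _ _ _] [_ _ cTC cLBC _ _ _ _].
(* One orientation of each forced pair, read off in [G1] or [G2], or from [su_AC] for [A]-[C];
   symmetry of [adj G] gives the other. *)
have half X' Y' x' y' b' : x' \in part_set X' -> y' \in part_set Y' ->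
    x' != y' ->
    match X', Y' with
    | InA, InB | InL, InB | InL, InC | InL, InL => b' = true
    | InA, InT | InA, InC | InT, InC | InT, InT => b' = false
    | _, _ => False
    end -> adj G x' y' = b'.
  move=> xX yY xy; have h1 := adj_left xX yY; have h2 := adj_right xX yY.
  case: X' Y' xX yY h1 h2 => -[] //= xX yY h1 h2 ->.
  - by rewrite h1 // cAB.
  - exact/negbTE/(su_AC HG).
  - by rewrite h1 //; apply/negbTE/cAT.
  - by rewrite h2 // cLBC // inE yY.
  - by rewrite h2 // cLBC // inE yY orbT.
  - by rewrite h1 // cL.
  - by rewrite h2 //; apply/negbTE/cTC.
  - by rewrite h1 //; apply/negbTE/cT.
move=> xX yY xy; have yx : y != x by rewrite eq_sym.
have := half _ _ _ _ b xX yY xy; have := half _ _ _ _ b yY xX yx.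
rewrite [adj G y x]adj_sym.
by case: X Y {xX yY} => -[] //= hY hX [bE]; first [exact: hX | exact: hY].
Qed.

(** Nonadjacent [y] and [z] lie in the same anticomponent of [B], and seeing exactly one of them
    would make [x] mixed on it. *)
Lemma adj_mixed x y z : x \in C -> y \in B -> z \in B ->
  y != z -> ~~ adj G y z -> adj G x y = adj G x z.
Proof.
case: Hpair => _ _ G2P xC yB zB yz nyz.
rewrite !(@adj_right InC InB) //.
rewrite (@adj_right InB InB) // in nyz.
have [yG2 zG2] : y \in vset G2 /\ z \in vset G2.
  by split; apply: (@part_vset2 InB).
set K := [set w | connect (adj (compl (induced G2 B))) y w].
have yK : y \in K by rewrite inE connect0.
have zK : z \in K.
  rewrite inE connect1 //= /compl_adj /= /induced_adj !inE.
  by rewrite yB zB yG2 zG2 yz nyz.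
have Kac : anticomponent G2 B K by exists y; rewrite //= inE yB.
have nm := cr_mixed G2P xC Kac.
apply/idP/idP => xw; apply/negPn/negP => nxw; apply: nm; split=> h.
- by move: (h _ zK); rewrite (negbTE nxw).
- by move: (h _ yK); rewrite xw.
- by move: (h _ yK); rewrite (negbTE nxw).
- by move: (h _ zK); rewrite xw.
Qed.

Lemma adj_c X x : x \in part_set X -> ~~ isC X ->
  adj G1 c x = isB X || isL X.
Proof.
case: Hpair => _ [_ _ _ _ _ _ cBL cAT] _; case: X => //= xX _.
all: by [apply: cBL; rewrite inE xX ?orbT
       | apply/negbTE/cAT; rewrite inE xX ?orbT].
Qed.

Lemma adj_a X x : x \in part_set X -> ~~ isA X ->
  adj G2 a x = isB X || isL X.
Proof.
case: Hpair => _ _ [_ _ _ _ aBL aCT _ _]; case: X => //= xX _.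
all: by [apply: aBL; rewrite inE xX ?orbT
       | apply/negbTE/aCT; rewrite inE xX ?orbT].
Qed.

(** The value agrees with [adj_c], which makes [y] and [c] interchangeable as seen from outside [C].
    [adj_A] and [adj_a] play the same roles for [A], with [L] in place of [B] as the part to be
    assumed. *)
Lemma adj_C X x y : y \in C -> x \in part_set X -> ~~ isC X ->
  (isB X -> adj G y x) -> adj G y x = isB X || isL X.
Proof.
case: Hpair => _ _ [_ _ cTC cLBC _ _ _ _] yC xX.
have h := @adj_right InC X y x yC xX isT.
case: X xX h => //= xX h _ => [_||_|_].
- by rewrite adj_sym; apply/negbTE/(su_AC HG).
- exact.
- by rewrite h // adj_sym cLBC // inE yC orbT.
- by rewrite h // adj_sym; apply/negbTE/cTC.
Qed.

Lemma adj_A X x y : y \in A -> x \in part_set X -> ~~ isA X ->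
  (isL X -> adj G y x) -> adj G y x = isB X || isL X.
Proof.
case: Hpair => _ [_ _ _ cAB cAT _ _ _] _ yA xX.
have h := @adj_left InA X y x yA xX isT.
case: X xX h => //= xX h _ => [_|_||_].
- by rewrite h // cAB.
- exact/negbTE/(su_AC HG).
- exact.
- by rewrite h //; apply/negbTE/cAT.
Qed.

(** * Moving copies of the pattern between the graphs *)

Section Pattern.
Variable H : sgraph 'I_5.

Lemma embedding_left f : embedding H G1 f -> exists f', embedding H G f'.
Proof.
move=> fE; case: Hpair => _ _ G2P; have [y yC yB] := cr_CB G2P.
have fP i : f i != c -> exists2 X, ~~ isC X & f i \in part_set X.
  by apply: vset1P; case: fE.
eexists; apply: (@embedding_replace _ _ _ _ _ _ (fun i => f i == c) y fE).
- exact: (@part_vset InC).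
- by move=> i /fP[X _ /part_vset].
- by move=> i j /fP[X XC fi] /fP[Y YC fj]; apply: adj_left fi fj XC YC.
- by move=> i j /eqP-> /eqP->; rewrite adj_irr.
- move=> i j /eqP-> /fP[X XC fj]; rewrite (adj_c fj XC); apply: adj_C => //.
  by case: X XC fj => //= _ fj _; rewrite (@adj_right InC InB) ?yB.
Qed.

Lemma embedding_right f : embedding H G2 f -> exists f', embedding H G f'.
Proof.
move=> fE; case: Hpair => _ G1P _; have [y yA yL] := cl_AL G1P.
have fP i : f i != a -> exists2 X, ~~ isA X & f i \in part_set X.
  by apply: vset2P; case: fE.
eexists; apply: (@embedding_replace _ _ _ _ _ _ (fun i => f i == a) y fE).
- exact: (@part_vset InA).
- by move=> i /fP[X _ /part_vset].
- by move=> i j /fP[X XA fi] /fP[Y YA fj]; apply: adj_right fi fj XA YA.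
- by move=> i j /eqP-> /eqP->; rewrite adj_irr.
- move=> i j /eqP-> /fP[X XA fj]; rewrite (adj_a fj XA); apply: adj_A => //.
  by case: X XA fj => //= _ fj _; rewrite (@adj_left InA InL) ?yL.
Qed.

Variable e : rel 'I_5.
Hypotheses (He : adj H =2 e) (ok : all_labellings_ok e).

Lemma replaceableP lab isX isY i j : replaceable e lab isX isY ->
  isX (lab i) -> (isX (lab j) -> ~~ adj H i j) /\ (isY (lab j) -> adj H i j).
Proof.
move=> /all5P/(_ i)/implyP h /h /all5P/(_ j).
by rewrite He => /andP[/implyP ? /implyP].
Qed.

Lemma embedding_split f : point_determining H -> embedding H G f ->
  (exists f', embedding H G2 f') \/ (exists f', embedding H G1 f').
Proof.
move=> Hpd fE; have [fG fadj] := fE; pose lab i := part_of (f i).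
have labP i : f i \in part_set (lab i) by apply: part_ofP.
have inA i : isA (lab i) -> f i \in A by move: (labP i); case: (lab i).
have inB i : isB (lab i) -> f i \in B by move: (labP i); case: (lab i).
have inC i : isC (lab i) -> f i \in C by move: (labP i); case: (lab i).
(* Needed because [adj_forced] and [adj_mixed] speak of distinct vertices of [G]. *)
have fneq i j : i != j -> f i != f j.
  by apply: contra_neq => fij; apply: Hpd => k; rewrite -!fadj fij.
have lab_forced : respects_forced e lab.
  apply/all5P=> i; apply/all5P=> j; apply/implyP=> /fneq fij.
  case E: forced => [b|] //.
  by rewrite -He -fadj (adj_forced (labP i) (labP j) fij E).
have lab_mixed : respects_mixed e lab.
  apply/all5P=> i; apply/implyP=> /inC iC.
  apply/all5P=> j; apply/implyP=> /inB jB.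
  apply/all5P=> k; apply/implyP=> /and3P[/inB kB /fneq fjk].
  by rewrite -!He -!fadj => njk; apply/eqP/adj_mixed.
have := all_labellings_okP lab ok.
rewrite /labelling_ok lab_forced lab_mixed /= => /orP[rA | rC].
- left; eexists.
  apply: (@embedding_replace _ _ _ _ _ _ (fun i => isA (lab i)) a fE).
  + by case: Hpair => _ _ G2P; rewrite (cr_vset G2P) !inE eqxx orbT.
  + by move=> i; apply: part_vset2.
  + by move=> i j iA jA; rewrite (adj_right (labP i) (labP j)).
  + by move=> i j iA jA; rewrite fadj; apply: (replaceableP j rA iA).1.
  (* [f i] and [a] see [f j] alike; the required adjacency to [L] is the second half of
     [replaceable]. *)
  + move=> i j iA jA; rewrite (adj_a (labP j) jA); apply/esym/adj_A => //.
      exact: inA.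
    by rewrite fadj; apply: (replaceableP j rA iA).2.
- right; eexists.
  apply: (@embedding_replace _ _ _ _ _ _ (fun i => isC (lab i)) c fE).
  + by case: Hpair => _ G1P _; rewrite (cl_vset G1P) !inE eqxx orbT.
  + by move=> i; apply: part_vset1.
  + by move=> i j iC jC; rewrite (adj_left (labP i) (labP j)).
  + by move=> i j iC jC; rewrite fadj; apply: (replaceableP j rC iC).1.
  + move=> i j iC jC; rewrite (adj_c (labP j) jC); apply/esym/adj_C => //.
      exact: inC.
    by rewrite fadj; apply: (replaceableP j rC iC).2.
Qed.

End Pattern.

End SplitUnification.

Theorem theorem4p2 (V : finType) (A B C L T : {set V}) (a c : V)
    (G1 G2 G : sgraph V)
    (Hpair : composable_pair A B C L T a c G1 G2)
    (HG : split_unification A B C L T a c G1 G2 G)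
    (H : sgraph 'I_5)
    (HH : [\/ H = P5, H = compl P5 | H = C5]) :
  free H G <-> free H G1 /\ free H G2.
Proof.
have [HT [e He /andP[te ok]]] := pattern_check HH.
have Hpd := twin_freeP He te.
split=> [/(freeP _ HT Hpd) nG | [/(freeP _ HT Hpd) nG1 /(freeP _ HT Hpd) nG2]].
  by split; apply/(freeP _ HT Hpd) => -[f fE]; apply: nG;
    [apply: (embedding_left Hpair HG fE) | apply: (embedding_right Hpair HG fE)].
apply/(freeP _ HT Hpd) => -[f fE].
by case: (embedding_split Hpair HG He ok Hpd fE) => [/nG2 | /nG1].
Qed.
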